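(* Let $r,s,t$ be real numbers, let $W_0,W_1,W_2$ be complex numbers, and let $(W_n)_{n\ge 0}$ be the generalized Tribonacci sequence defined by $W_n=rW_{n-1}+sW_{n-2}+tW_{n-3}$ for $n\ge 3$. Then for every integer $n\ge 0$: (a) If $r+s+t-1\neq 0$, then $$\sum_{k=0}^{n}W_{k}=\frac{W_{n+3}+(1-r)W_{n+2}+(1-r-s)W_{n+1}-W_{2}+(r-1)W_{1}+(r+s-1)W_{0}}{r+s+t-1}.$$ (b) If $2s+2rt+r^{2}-s^{2}+t^{2}-1=(r+s+t-1)(r-s+t+1)\neq 0$, then $$\sum_{k=0}^{n}W_{2k}=\frac{(-s+1)W_{2n+2}+(t+rs)W_{2n+1}+(t^{2}+rt)W_{2n}+(-1+s)W_{2}+(-t-rs)W_{1}+(-1+r^{2}-s^{2}+rt+2s)W_{0}}{(r+s+t-1)(r-s+t+1)}$$ and $$\sum_{k=0}^{n}W_{2k+1}=\frac{(r+t)W_{2n+2}+(s-s^{2}+t^{2}+rt)W_{2n+1}+(t-st)W_{2n}+(-r-t)W_{2}+(-1+s+r^{2}+rt)W_{1}+(-t+st)W_{0}}{(r-s+t+1)(r+s+t-1)}.$$ (c) If $r+t\neq 0$ and $s=1$, then $$\sum_{k=0}^{n}W_{2k}=\frac{1}{r+t}\left(W_{2n+1}+tW_{2n}-W_{1}+rW_{0}\right)$$ and $$\sum_{k=0}^{n}W_{2k+1}=\frac{1}{r+t}\left(W_{2n+2}+tW_{2n+1}-W_{2}+rW_{1}\right).$$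
   Context: The initial values $W_0,W_1,W_2$ are arbitrary complex numbers and $r,s,t$ are arbitrary real numbers. *)

(* Defs.v *)
From mathcomp Require Import all_boot all_order all_algebra.
From mathcomp Require Import reals complex.

Set Implicit Arguments.
Unset Strict Implicit.
Unset Printing Implicit Defensive.

Import GRing.Theory.

Local Open Scope ring_scope.
Local Open Scope complex_scope.

Definition generalized_tribonacci (R : realType) (r s t : R)
    (W0 W1 W2 : R[i]) (W : nat -> R[i]) : Prop :=
  [/\ W 0%N = W0, W 1%N = W1, W 2%N = W2 &
      forall n : nat, (3 <= n)%N ->
        W n = r%:C * W (n - 1)%N + s%:C * W (n - 2)%N + t%:C * W (n - 3)%N].

(* Main.v *)
Require Import Defs.
From mathcomp Require Import all_boot all_order all_algebra.
From mathcomp Require Import reals complex ring.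

Set Implicit Arguments.
Unset Strict Implicit.
Unset Printing Implicit Defensive.

Import GRing.Theory.

Local Open Scope ring_scope.
Local Open Scope complex_scope.

(** Multiplied by its denominator [d], each formula reads [d * sum = G n], where
    the recurrence gives [G 0 = d * u 0] and [G n.+1 - G n = d * u n.+1]; the
    sum therefore telescopes. *)

(** Each closed form is first proved without division, over any commutative ring. The recurrence
    lowers the high indices in the base case and in the increment of the telescoping sum, which
    leaves a polynomial identity for [ring]. The theorem instantiates these identities in [R[i]] and
    divides by the denominator, a nonzero real embedded in the complex numbers. *)

Lemma mul_sum_telescope (A : pzRingType) (d : A) (u G : nat -> A) :
    G 0%N = d * u 0%N -> (forall n, G n.+1 = G n + d * u n.+1) ->
  forall n, d * (\sum_(0 <= k < n.+1) u k) = G n.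
Proof.
move=> G0 GS; elim=> [|n IHn]; first by rewrite big_nat1 G0.
by rewrite big_nat_recr //= mulrDr IHn GS.
Qed.

Section LinearRecurrence.

Variables (A : comPzRingType) (r s t : A) (W : nat -> A).
Hypothesis W_rec : forall n, W n.+3 = r * W n.+2 + s * W n.+1 + t * W n.

Lemma tribonacci_sum n :
  (r + s + t - 1) * (\sum_(0 <= k < n.+1) W k) =
    W n.+3 + (1 - r) * W n.+2 + (1 - r - s) * W n.+1
    - W 2 + (r - 1) * W 1 + (r + s - 1) * W 0.
Proof.
move: n; apply: mul_sum_telescope => [|n]; rewrite !W_rec; ring.
Qed.

(** With p(x) = x^3 - r x^2 - s x - t, the factor is p(1) p(-1). The even-indexed terms obey a
    recurrence whose characteristic polynomial q satisfies q(x^2) = - p(x) p(-x), so the factor is -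
    q(1), just as r + s + t - 1 is - p(1). *)
Lemma tribonacci_sum_even n :
  ((r + s + t - 1) * (r - s + t + 1)) * (\sum_(0 <= k < n.+1) W k.*2) =
    (- s + 1) * W n.*2.+2 + (t + r * s) * W n.*2.+1
    + (t ^+ 2 + r * t) * W n.*2
    + (- 1 + s) * W 2 + (- t - r * s) * W 1
    + (- 1 + r ^+ 2 - s ^+ 2 + r * t + 2 * s) * W 0.
Proof.
move: n; apply: mul_sum_telescope => [|n]; rewrite ?doubleS ?W_rec; ring.
Qed.

Lemma tribonacci_sum_odd n :
  ((r - s + t + 1) * (r + s + t - 1)) * (\sum_(0 <= k < n.+1) W k.*2.+1) =
    (r + t) * W n.*2.+2 + (s - s ^+ 2 + t ^+ 2 + r * t) * W n.*2.+1
    + (t - s * t) * W n.*2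
    + (- r - t) * W 2 + (- 1 + s + r ^+ 2 + r * t) * W 1
    + (- t + s * t) * W 0.
Proof.
move: n; apply: mul_sum_telescope => [|n]; rewrite ?doubleS ?W_rec; ring.
Qed.

(** At [s = 1] the general factor becomes (r + t)^2 and the numerator is a multiple of r + t. A
    commutative ring need not allow cancelling r + t, so the smaller factor is telescoped
    directly. *)
Lemma tribonacci_sum_even_s1 n : s = 1 ->
  (r + t) * (\sum_(0 <= k < n.+1) W k.*2) =
    W n.*2.+1 + t * W n.*2 - W 1 + r * W 0.
Proof.
move=> s1; move: n; apply: mul_sum_telescope => [|n];
  rewrite ?doubleS ?W_rec ?s1; ring.
Qed.

Lemma tribonacci_sum_odd_s1 n : s = 1 ->
  (r + t) * (\sum_(0 <= k < n.+1) W k.*2.+1) =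
    W n.*2.+2 + t * W n.*2.+1 - W 2 + r * W 1.
Proof.
move=> s1; move: n; apply: mul_sum_telescope => [|n];
  rewrite ?doubleS ?W_rec ?s1; ring.
Qed.

End LinearRecurrence.

Theorem theorem2p1 (R : realType) (r s t : R) (W0 W1 W2 : R[i])
    (W : nat -> R[i]) (hW : generalized_tribonacci r s t W0 W1 W2 W) (n : nat) :
  (* (a) *)
  (r + s + t - 1 <> 0 ->
    \sum_(0 <= k < n.+1) W k =
      (W (n + 3)%N + (1 - r)%:C * W (n + 2)%N + (1 - r - s)%:C * W (n + 1)%N
       - W2 + (r - 1)%:C * W1 + (r + s - 1)%:C * W0)
      / (r + s + t - 1)%:C)
  /\
  (* (b) *)
  (2 * s + 2 * r * t + r ^+ 2 - s ^+ 2 + t ^+ 2 - 1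
     = (r + s + t - 1) * (r - s + t + 1)
   /\
   (2 * s + 2 * r * t + r ^+ 2 - s ^+ 2 + t ^+ 2 - 1 <> 0 ->
    \sum_(0 <= k < n.+1) W (2 * k)%N =
      ((- s + 1)%:C * W (2 * n + 2)%N + (t + r * s)%:C * W (2 * n + 1)%N
       + (t ^+ 2 + r * t)%:C * W (2 * n)%N
       + (- 1 + s)%:C * W2 + (- t - r * s)%:C * W1
       + (- 1 + r ^+ 2 - s ^+ 2 + r * t + 2 * s)%:C * W0)
      / ((r + s + t - 1) * (r - s + t + 1))%:C
    /\
    \sum_(0 <= k < n.+1) W (2 * k + 1)%N =
      ((r + t)%:C * W (2 * n + 2)%N
       + (s - s ^+ 2 + t ^+ 2 + r * t)%:C * W (2 * n + 1)%N
       + (t - s * t)%:C * W (2 * n)%N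
       + (- r - t)%:C * W2 + (- 1 + s + r ^+ 2 + r * t)%:C * W1
       + (- t + s * t)%:C * W0)
      / ((r - s + t + 1) * (r + s + t - 1))%:C))
  /\
  (* (c) *)
  (r + t <> 0 -> s = 1 ->
    \sum_(0 <= k < n.+1) W (2 * k)%N =
      1 / (r + t)%:C
      * (W (2 * n + 1)%N + t%:C * W (2 * n)%N - W1 + r%:C * W0)
    /\
    \sum_(0 <= k < n.+1) W (2 * k + 1)%N =
      1 / (r + t)%:C
      * (W (2 * n + 2)%N + t%:C * W (2 * n + 1)%N - W2 + r%:C * W1)).
Proof.
case: hW => <- <- <- W_rec3.
have W_rec m : W m.+3 = r%:C * W m.+2 + s%:C * W m.+1 + t%:C * W m.
  by rewrite W_rec3 // !subSS !subn0.
have solve (d : R) (x y : R[i]) : d <> 0 -> d%:C * x = y -> x = y / d%:C.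
  move=> /eqP d0 <-; rewrite mulrAC mulfV ?mul1r //.
  by rewrite (fmorph_eq0 (real_complex R)).
(* With [doubleS], the form [k.*2] exposes the successors that [W_rec] matches. *)
have even_sum : \sum_(0 <= k < n.+1) W (2 * k)%N = \sum_(0 <= k < n.+1) W k.*2.
  by under eq_bigr do rewrite mul2n.
have odd_sum :
    \sum_(0 <= k < n.+1) W (2 * k + 1)%N = \sum_(0 <= k < n.+1) W k.*2.+1.
  by under eq_bigr do rewrite mul2n addn1.
have factored : 2 * s + 2 * r * t + r ^+ 2 - s ^+ 2 + t ^+ 2 - 1
    = (r + s + t - 1) * (r - s + t + 1) by ring.
have pushC := (rmorphD (real_complex R), rmorphB (real_complex R),
  rmorphN (real_complex R), rmorphM (real_complex R),
  rmorphXn (real_complex R), rmorph1 (real_complex R),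
  rmorph_nat (real_complex R)).
rewrite even_sum odd_sum mul2n !addn1 !addn2 !addn3.
split; [|split; [split => //|]].
- by move=> d0; apply: (solve _ _ _ d0); rewrite !pushC tribonacci_sum.
- rewrite factored => d0; split; apply: solve => //.
  + by rewrite !pushC tribonacci_sum_even.
  (* The odd formula has the two factors of the denominator in the opposite order. *)
  + by rewrite mulrC.
  + by rewrite !pushC tribonacci_sum_odd.
- move=> d0 s1; have s1C : s%:C = 1 by rewrite s1 rmorph1.
  (* The leading inverse is moved to the right, giving the quotient shape of [solve]. *)
  rewrite !(mulrC (1 / _)) !mulrA !mulr1; split; apply: solve => //.
  + by rewrite !pushC (tribonacci_sum_even_s1 W_rec).
  + by rewrite !pushC (tribonacci_sum_odd_s1 W_rec).
Qed.
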